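(* Let $k$ be a field, let $J$ be a small category and let $F : J \to k\text{-BiAlg}$ be a functor. Let $\bigl(\prod_{j \in J} F(j), (p_j)_{j \in J}\bigr)$ and $\bigl(\prod_{u \in \mathrm{Hom}(J)} F(\mathrm{cod}(u)), (p_u)_{u \in \mathrm{Hom}(J)}\bigr)$ be the products in $k\text{-BiAlg}$ of the families $(F(j))_{j \in J}$ and $(F(\mathrm{cod}(u)))_{u \in \mathrm{Hom}(J)}$, respectively. Let $f, g : \prod_{j \in J} F(j) \to \prod_{u \in \mathrm{Hom}(J)} F(\mathrm{cod}(u))$ be the unique bialgebra maps such that $p_u \circ f = p_{\mathrm{cod}(u)}$ and $p_u \circ g = F(u) \circ p_{\mathrm{dom}(u)}$ for all $u \in \mathrm{Hom}(J)$. Define $$D = \Bigl\{ x \in \prod_{j \in J} F(j) \;\Big|\; x_{(1)} \otimes f(x_{(2)}) \otimes x_{(3)} = x_{(1)} \otimes g(x_{(2)}) \otimes x_{(3)} \Bigr\}$$ and let $e : D \to \prod_{j \in J} F(j)$ be the canonical inclusion. Then the pair $\bigl(D, (\varphi_j = p_j \circ e)_{j \in J}\bigr)$, where $D$ carries the bialgebra structure induced from $\prod_{j \in J} F(j)$, is the limit of the functor $F$ in $k\text{-BiAlg}$.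
   Context: $k\text{-BiAlg}$ denotes the category of bialgebras over the field $k$ with bialgebra maps as morphisms; all products $\prod$ in the claim are categorical products in $k\text{-BiAlg}$ (which exist), not products of vector spaces. Tensor products are over $k$. Sweedler's notation is used: $\Delta(x) = x_{(1)} \otimes x_{(2)}$ and $(\mathrm{Id} \otimes \Delta)\Delta(x) = x_{(1)} \otimes x_{(2)} \otimes x_{(3)}$, summation understood. For a small category $J$, the index $j \in J$ runs over the objects of $J$, $\mathrm{Hom}(J)$ is the set of all morphisms of $J$, and for a morphism $u$, $\mathrm{dom}(u)$ and $\mathrm{cod}(u)$ are its domain and codomain. *)

(* Defs.v *)
From HB Require Import structures.
From mathcomp Require Import all_boot ssralg sesquilinear.
From mathcomp Require Import boolp classical_sets.

Set Implicit Arguments.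
Unset Strict Implicit.
Unset Printing Implicit Defensive.

Import GRing.Theory.

Local Open Scope ring_scope.
Local Open Scope quotient_scope.

Reserved Notation "v \ox w" (at level 40, left associativity).

(* A sequence [:: (v_1, w_1); ...; (v_n, w_n)] stands for the formal sum of
   the v_i (x) w_i, and tens V W is the set of formal sums modulo the congruence
   generated by bilinearity.  A scalar acts on the left factors, so formal sums
   need no coefficients. *)
Section TensorProduct.
Variables (R : comNzRingType) (V W : lmodType R).
Implicit Types (v : V) (w : W) (s t : seq (V * W)).

Inductive tens_cong : seq (V * W) -> seq (V * W) -> Prop :=
| TensRefl s : tens_cong s s
| TensSym s t : tens_cong s t -> tens_cong t s
| TensTrans s t r : tens_cong s t -> tens_cong t r -> tens_cong s r
| TensCat s s' t t' :
    tens_cong s s' -> tens_cong t t' -> tens_cong (s ++ t) (s' ++ t')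
| TensCatC s t : tens_cong (s ++ t) (t ++ s)
| TensAddl v v' w : tens_cong [:: (v + v', w)] [:: (v, w); (v', w)]
| TensAddr v w w' : tens_cong [:: (v, w + w')] [:: (v, w); (v, w')]
| TensScale a v w : tens_cong [:: (a *: v, w)] [:: (v, a *: w)]
| TensZero w : tens_cong [:: (0, w)] [::].

Definition tens_eqb s t := `[< tens_cong s t >].

Lemma tens_eqb_refl : reflexive tens_eqb.
Proof. by move=> s; apply/asboolP; exact: TensRefl. Qed.

Lemma tens_eqb_sym : symmetric tens_eqb.
Proof. by move=> s t; apply/asboolP/asboolP; exact: TensSym. Qed.

Lemma tens_eqb_trans : transitive tens_eqb.
Proof.
by move=> s t r /asboolP ts /asboolP sr; apply/asboolP; exact: TensTrans ts sr.
Qed.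

Canonical tens_equiv :=
  EquivRel tens_eqb tens_eqb_refl tens_eqb_sym tens_eqb_trans.

Definition tens := {eq_quot tens_equiv}.

HB.instance Definition _ := Choice.on tens.
HB.instance Definition _ := EqQuotient.on tens.

Lemma tens_piP s t : tens_cong s t <-> \pi_tens s = \pi_tens t.
Proof.
split=> [st|/eqP]; first by apply/eqP; rewrite eqmodE; apply/asboolP.
by rewrite eqmodE => /asboolP.
Qed.

Lemma tens_repr s : tens_cong (repr (\pi_tens s)) s.
Proof. by apply/tens_piP; rewrite reprK. Qed.

Lemma tens_quotW (P : tens -> Prop) :
  (forall s, P (\pi_tens s)) -> forall x, P x.
Proof. by move=> Ppi x; rewrite -[x]reprK. Qed.

Definition tens0 : tens := \pi_tens [::].
Definition tens_add (x y : tens) : tens := \pi_tens (repr x ++ repr y).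
Definition tens_scale (a : R) (x : tens) : tens :=
  \pi_tens [seq (a *: p.1, p.2) | p <- repr x].

Lemma tens_addE s t : tens_add (\pi_tens s) (\pi_tens t) = \pi_tens (s ++ t).
Proof. by apply/tens_piP/TensCat; exact: tens_repr. Qed.

Lemma tens_scale_cong a s t : tens_cong s t ->
  tens_cong [seq (a *: p.1, p.2) | p <- s] [seq (a *: p.1, p.2) | p <- t].
Proof.
elim=> {s t} [s|s t _ st|s t r _ st _ tr|s s' t t' _ st _ st'|s t|v v' w|v w w'
             |b v w|w] /=.
- exact: TensRefl.
- exact: TensSym.
- exact: TensTrans st tr.
- by rewrite !map_cat; exact: TensCat.
- by rewrite !map_cat; exact: TensCatC.
- by rewrite scalerDr; exact: TensAddl.
- exact: TensAddr.
- rewrite scalerA mulrC -scalerA; exact: TensScale.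
- by rewrite scaler0; exact: TensZero.
Qed.

Lemma tens_scaleE a s :
  tens_scale a (\pi_tens s) = \pi_tens [seq (a *: p.1, p.2) | p <- s].
Proof. by apply/tens_piP/tens_scale_cong; exact: tens_repr. Qed.

Lemma tens_addA : associative tens_add.
Proof.
move=> x y z; elim/tens_quotW: x => s; elim/tens_quotW: y => t.
by elim/tens_quotW: z => r; rewrite !tens_addE catA.
Qed.

Lemma tens_addC : commutative tens_add.
Proof.
move=> x y; elim/tens_quotW: x => s; elim/tens_quotW: y => t.
by rewrite !tens_addE; apply/tens_piP/TensCatC.
Qed.

Lemma tens_add0 : left_id tens0 tens_add.
Proof. by move=> x; elim/tens_quotW: x => s; rewrite tens_addE. Qed.

Lemma tens_cong_scaleD a b s :
  tens_cong [seq ((a + b) *: p.1, p.2) | p <- s]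
    ([seq (a *: p.1, p.2) | p <- s] ++ [seq (b *: p.1, p.2) | p <- s]).
Proof.
elim: s => [|[v w] s IHs] /=; first exact: TensRefl.
rewrite -cat1s scalerDl.
apply: TensTrans (TensCat (TensAddl _ _ _) IHs) _ => /=.
rewrite -[_ :: _ :: _]cat1s -[X in tens_cong _ X]cat1s.
apply: TensCat; first exact: TensRefl.
rewrite -cat1s catA -[X in tens_cong _ (_ ++ X)]cat1s catA.
by apply: TensCat; [exact: TensCatC|exact: TensRefl].
Qed.

Lemma tens_scale1 : left_id 1 tens_scale.
Proof.
move=> x; elim/tens_quotW: x => s; rewrite tens_scaleE; congr (\pi_tens _).
by rewrite -[RHS]map_id; apply: eq_map => -[v w] /=; rewrite scale1r.
Qed.

Lemma tens_addN : left_inverse tens0 (tens_scale (-1)) tens_add.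
Proof.
move=> x; elim/tens_quotW: x => s.
rewrite -{2}[\pi_tens s]tens_scale1 !tens_scaleE tens_addE; apply/tens_piP.
apply: TensTrans (TensSym (tens_cong_scaleD (-1) 1 s)) _.
elim: s => [|[v w] s IHs] /=; first exact: TensRefl.
rewrite -cat1s -[X in tens_cong _ X]cats0; apply: TensCat => //.
by rewrite addNr scale0r; exact: TensZero.
Qed.

HB.instance Definition _ :=
  GRing.isZmodule.Build tens tens_addA tens_addC tens_add0 tens_addN.

Lemma tens_scaleA a b x : tens_scale a (tens_scale b x) = tens_scale (a * b) x.
Proof.
elim/tens_quotW: x => s; rewrite !tens_scaleE -map_comp; congr (\pi_tens _).
by apply: eq_map => -[v w] /=; rewrite scalerA.
Qed.

Lemma tens_scaleDr : right_distributive tens_scale +%R.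
Proof.
move=> a x y; elim/tens_quotW: x => s; elim/tens_quotW: y => t.
by rewrite /+%R /= tens_addE !tens_scaleE tens_addE map_cat.
Qed.

Lemma tens_scaleDl x : {morph tens_scale^~ x : a b / a + b}.
Proof.
move=> a b; elim/tens_quotW: x => s.
rewrite [in RHS]/+%R /= !tens_scaleE tens_addE.
exact/tens_piP/tens_cong_scaleD.
Qed.

HB.instance Definition _ := GRing.Zmodule_isLmodule.Build R tens
  tens_scaleA tens_scale1 tens_scaleDr tens_scaleDl.

Definition tens_pure v w : tens := \pi_tens [:: (v, w)].

Local Notation "v \ox w" := (tens_pure v w).

Lemma tens_pure_bilinear : bilinear_for *:%R *:%R tens_pure.
Proof.
split=> [w|v] a x y.
- rewrite /tens_pure /+%R /= /*:%R /= tens_scaleE tens_addE.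
  exact/tens_piP/TensAddl.
- rewrite /tens_pure /+%R /= /*:%R /= tens_scaleE tens_addE /=.
  apply/tens_piP; apply: TensTrans (TensAddr _ _ _) _.
  rewrite -[X in tens_cong X _]cat1s -[X in tens_cong _ X]cat1s.
  by apply: TensCat (TensRefl _); exact/TensSym/TensScale.
Qed.

HB.instance Definition _ :=
  bilinear_isBilinear.Build R V W tens *:%R *:%R tens_pure tens_pure_bilinear.

Lemma tens_sum_pure (x : tens) : x = \sum_(p <- repr x) p.1 \ox p.2.
Proof.
rewrite -[LHS]reprK; elim: (repr x) => [|[v w] s IHs]; first by rewrite big_nil.
by rewrite big_cons -IHs /= /tens_pure [in RHS]/+%R /= tens_addE.
Qed.

Lemma tens_ind (P : tens -> Prop) : P 0 -> (forall v w, P (v \ox w)) ->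
  (forall x y, P x -> P y -> P (x + y)) -> forall x, P x.
Proof. by move=> P0 Pp PD x; rewrite (tens_sum_pure x); apply: big_ind. Qed.

Section Lift.
Variables (U : lmodType R) (b : {bilinear V -> W -> U}).

Definition tens_lift (x : tens) : U := \sum_(p <- repr x) b p.1 p.2.

Lemma tens_lift_cong s t : tens_cong s t ->
  \sum_(p <- s) b p.1 p.2 = \sum_(p <- t) b p.1 p.2.
Proof.
elim=> {s t} [s|s t _ st|s t r _ st _ tr|s s' t t' _ st _ st'|s t|v v' w|v w w'
             |a v w|w] //=.
- by rewrite st.
- by rewrite !big_cat /= st st'.
- by rewrite !big_cat /= addrC.
- by rewrite !big_cons !big_nil !addr0 linearDl.
- by rewrite !big_cons !big_nil !addr0 linearDr.
- by rewrite !big_cons !big_nil !addr0 linearZr linearZl_LR.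
- by rewrite !big_cons !big_nil !addr0 linear0l.
Qed.

Lemma tens_lift_pi s : tens_lift (\pi_tens s) = \sum_(p <- s) b p.1 p.2.
Proof. exact/tens_lift_cong/tens_repr. Qed.

Lemma tens_lift_linear : linear tens_lift.
Proof.
move=> a x y; elim/tens_quotW: x => s; elim/tens_quotW: y => t.
rewrite [in LHS]/+%R /= [in LHS]/*:%R /= tens_scaleE tens_addE !tens_lift_pi.
rewrite big_cat /= scaler_sumr big_map; congr (_ + _).
by apply: eq_bigr => p _; rewrite linearZl_LR.
Qed.

HB.instance Definition _ :=
  GRing.isLinear.Build R tens U *:%R tens_lift tens_lift_linear.

Lemma tens_liftE v w : tens_lift (v \ox w) = b v w.
Proof. by rewrite tens_lift_pi big_seq1. Qed.

End Lift.

Lemma tens_eq_linear (U : lmodType R) (f g : {linear tens -> U}) :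
  (forall v w, f (v \ox w) = g (v \ox w)) -> f =1 g.
Proof.
move=> fg; elim/tens_ind => [|v w|x y fgx fgy]; rewrite ?linear0 ?fg //.
by rewrite !linearD fgx fgy.
Qed.

End TensorProduct.

Notation "v \ox w" := (tens_pure v w) : ring_scope.

Section TensorMap.
Variables (R : comNzRingType) (V V' W W' : lmodType R).
Variables (f : {linear V -> V'}) (g : {linear W -> W'}).

Definition tens_map_pure (v : V) (w : W) : tens V' W' := f v \ox g w.

Lemma tens_map_pure_bilinear : bilinear_for *:%R *:%R tens_map_pure.
Proof.
split=> [w|v] a x y /=; rewrite /tens_map_pure linearP.
- by rewrite linearPl.
- by rewrite linearPr.
Qed.

HB.instance Definition _ := bilinear_isBilinear.Build R V W (tens V' W')
  *:%R *:%R tens_map_pure tens_map_pure_bilinear.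

Definition tens_map : tens V W -> tens V' W' := tens_lift tens_map_pure.

HB.instance Definition _ := GRing.Linear.on tens_map.

Lemma tens_mapE v w : tens_map (v \ox w) = f v \ox g w.
Proof. exact: tens_liftE. Qed.

End TensorMap.

Lemma tens_map_id (R : comNzRingType) (V W : lmodType R) :
  tens_map (idfun : {linear V -> V}) (idfun : {linear W -> W}) =1 id.
Proof.
by apply: (tens_eq_linear (g := idfun)) => v w; rewrite /= tens_mapE.
Qed.

Lemma tens_map_comp (R : comNzRingType) (V V' V'' W W' W'' : lmodType R)
    (f' : {linear V' -> V''}) (f : {linear V -> V'})
    (g' : {linear W' -> W''}) (g : {linear W -> W'}) :
  tens_map f' g' \o tens_map f g =1 tens_map (f' \o f) (g' \o g).
Proof. by apply: tens_eq_linear => v w; rewrite /= !tens_mapE. Qed.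

Lemma eq_tens_map (R : comNzRingType) (V V' W W' : lmodType R)
    (f f' : {linear V -> V'}) (g g' : {linear W -> W'}) :
  f =1 f' -> g =1 g' -> tens_map f g =1 tens_map f' g'.
Proof.
by move=> ff' gg'; apply: tens_eq_linear => v w; rewrite /= !tens_mapE ff' gg'.
Qed.

Section TensorAssoc.
Variables (R : comNzRingType) (U V W : lmodType R).

Section Inner.
Variable w : W.

Definition tens_assoc_pure (u : U) (v : V) : tens U (tens V W) :=
  u \ox (v \ox w).

Lemma tens_assoc_pure_bilinear : bilinear_for *:%R *:%R tens_assoc_pure.
Proof.
split=> [v|u] a x y /=; rewrite /tens_assoc_pure.
- by rewrite linearPl.
- by rewrite linearPl linearPr.
Qed.

HB.instance Definition _ := bilinear_isBilinear.Build R U V (tens U (tens V W))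
  *:%R *:%R tens_assoc_pure tens_assoc_pure_bilinear.

End Inner.

Definition tens_assoc_map (x : tens U V) (w : W) : tens U (tens V W) :=
  tens_lift (tens_assoc_pure w) x.

Lemma tens_assoc_map_bilinear : bilinear_for *:%R *:%R tens_assoc_map.
Proof.
split=> [w|x] a y z /=; first by rewrite /tens_assoc_map linearP.
rewrite /tens_assoc_map.
elim/tens_ind: x => [|u v|x x' IHx IHx'].
- by rewrite !linear0 addr0; reflexivity.
- by rewrite !tens_liftE /= /tens_assoc_pure !linearPr.
- by rewrite !linearD /= IHx IHx' addrACA.
Qed.

HB.instance Definition _ :=
  bilinear_isBilinear.Build R (tens U V) W (tens U (tens V W))
  *:%R *:%R tens_assoc_map tens_assoc_map_bilinear.

Definition tens_assoc : tens (tens U V) W -> tens U (tens V W) :=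
  tens_lift tens_assoc_map.

HB.instance Definition _ := GRing.Linear.on tens_assoc.

Lemma tens_assocE u v w : tens_assoc ((u \ox v) \ox w) = u \ox (v \ox w).
Proof. by rewrite /tens_assoc tens_liftE /= /tens_assoc_map tens_liftE. Qed.

End TensorAssoc.

Lemma tens_eq_linear3 (R : comNzRingType) (U V W X : lmodType R)
    (f g : {linear tens (tens U V) W -> X}) :
  (forall u v w, f ((u \ox v) \ox w) = g ((u \ox v) \ox w)) -> f =1 g.
Proof.
move=> fg; apply: tens_eq_linear => x w.
elim/tens_ind: x => [|u v|x y fgx fgy]; first by rewrite linear0l !linear0.
  exact: fg.
by rewrite linearDl !linearD fgx fgy.
Qed.

Lemma tens_assoc_nat (R : comNzRingType) (U U' V V' W W' : lmodType R)
    (f : {linear U -> U'}) (g : {linear V -> V'}) (h : {linear W -> W'}) x :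
  tens_assoc (tens_map (tens_map f g) h x) =
  tens_map f (tens_map g h) (tens_assoc x).
Proof.
move: x; apply: (tens_eq_linear3 (f := tens_assoc (U := U') (V := V') (W := W')
  \o tens_map (tens_map f g) h) (g := tens_map f (tens_map g h) \o
  tens_assoc (U := U) (V := V) (W := W))) => u v w /=.
by rewrite !tens_mapE /= !tens_assocE !tens_mapE /= tens_assocE tens_mapE.
Qed.

Section LinearExtension.
Local Open Scope classical_set_scope.
Variables (k : fieldType) (S P U : lmodType k).
Variables (i : {linear S -> P}) (f : {linear S -> U}).
Hypothesis i_inj : injective i.

Let graph : set (P * U) := [set (i x, f x) | x in setT].
Let good (G : set (P * U)) :=
  (forall a p q, G p -> G q -> G (a *: p + q)) /\ (forall u, G (0, u) -> u = 0).

Let graph_good : good graph.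
Proof.
split=> [a _ _ [x _ <-] [y _ <-]|u [x _ [ix0 <-]]].
  by exists (a *: x + y) => //; rewrite !linearP.
by have -> : x = 0; [apply: i_inj; rewrite ix0 linear0|rewrite linear0].
Qed.

(* Zorn's lemma, applied to the graphs of partial linear maps that contain the
   graph of f \o i^-1. *)
Lemma linear_extension : exists g : {linear P -> U}, forall x, g (i x) = f x.
Proof.
have [|A [goodA maxA]] := @Zorn_bigcup (P * U)%type
    [set A | good (A `|` graph)].
  move=> F Fgood Fchain.
  have FE p q : (\bigcup_(X in F) X `|` graph) p ->
      (\bigcup_(X in F) X `|` graph) q ->
      exists G, [/\ good G, G `<=` \bigcup_(X in F) X `|` graph, G p & G q].
    case=> [[A FA Ap]|gp] [[B FB Bq]|gq].
    - have [AB|BA] := Fchain _ _ FA FB.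
      + exists (B `|` graph).
        split; [exact: Fgood| |by left; exact: AB|by left].
        by apply: setSU; exact: bigcup_sup.
      + exists (A `|` graph).
        split; [exact: Fgood| |by left|by left; exact: BA].
        by apply: setSU; exact: bigcup_sup.
    - exists (A `|` graph); split; [exact: Fgood| |by left|by right].
      by apply: setSU; exact: bigcup_sup.
    - exists (B `|` graph); split; [exact: Fgood| |by right|by left].
      by apply: setSU; exact: bigcup_sup.
    - by exists graph; split => //; exact: subsetUr.
  split=> [a p q Hp Hq|u Hu].
    have [G [[Glin _] GF Gp Gq]] := FE _ _ Hp Hq.
    exact/GF/Glin.
  by have [G [[_ Gfun] _ Gu _]] := FE _ _ Hu Hu; exact: Gfun.
pose G := A `|` graph.
have [Glin Gfun] : good G := goodA.
have G0 : G (0, 0) by right; exists 0 => //; rewrite !linear0.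
have Gdom x : exists u, G (x, u).
  apply: contrapT => xG.
  pose G' := [set p : P * U | exists a q, G q /\ p = a *: (x, 0) + q].
  have GG' : G `<=` G' by move=> p Gp; exists 0, p; rewrite scale0r add0r.
  have graphG' : graph `<=` G' by move=> p gp; apply: GG'; right.
  have G'x : G' (x, 0) by exists 1, (0, 0); rewrite scale1r addr0.
  apply: (maxA G'); last first.
    rewrite /= ((setUidPl _ _).2 graphG'); split=> [a ? ? [b [p [Gp ->]]]|u].
      move=> [c [q [Gq ->]]]; exists (a * b + c), (a *: p + q).
      split; first exact: Glin.
      by rewrite scalerDr scalerA scalerDl addrACA.
    move=> [a [[y v] [Gyv [/esym axy ->]]]]; move: axy.
    have [->|a0] := eqVneq a 0.
      rewrite scale0r add0r => y0; rewrite scale0r add0r.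
      by apply: Gfun; rewrite -y0.
    move=> axy; case: xG; exists (- a^-1 *: v).
    have -> : x = - a^-1 *: y.
      apply: (scalerI a0); rewrite scalerA mulrN divff // scaleN1r.
      by apply/eqP; rewrite -addr_eq0 axy.
    have := Glin (- a^-1) _ _ Gyv G0.
    by rewrite addr0.
  split; first by move=> p Ap; apply: GG'; left.
  by move=> /(_ _ G'x) Ax; apply: xG; exists 0; left.
have [g gP] := choice Gdom.
have Guniq x u v : G (x, u) -> G (x, v) -> u = v.
  move=> Gu Gv; have := Glin (-1) _ _ Gv Gu.
  rewrite scaleN1r => Guv; apply/eqP; rewrite -subr_eq0; apply/eqP/Gfun.
  by move: Guv; congr G; congr (_, _) => /=; [rewrite addNr|rewrite addrC].
have glin : linear g.
  move=> a x y; apply: Guniq (gP _) _.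
  exact: (Glin a _ _ (gP x) (gP y)).
pose gL := GRing.isLinear.Build k P U *:%R g glin.
pose gl : {linear P -> U} := HB.pack g gL.
exists gl => x; apply: Guniq (gP _) _.
by right; exists x.
Qed.

End LinearExtension.

Lemma tens_map_inj (k : fieldType) (V V' W W' : lmodType k)
    (f : {linear V -> V'}) (g : {linear W -> W'}) :
  injective f -> injective g -> injective (tens_map f g).
Proof.
move=> f_inj g_inj.
have [f' f'K] := linear_extension (idfun : {linear V -> V}) f_inj.
have [g' g'K] := linear_extension (idfun : {linear W -> W}) g_inj.
apply: (can_inj (g := tens_map f' g')) => x.
by rewrite [LHS]tens_map_comp -[RHS]tens_map_id; apply: eq_tens_map.
Qed.

Section TensorAlgebra.
Variables (k : fieldType) (A B : algType k).

Section LeftMultiplication.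
Variables (C : algType k) (a : C).

Definition lmul (x : C) : C := a * x.

Lemma lmul_linear : linear lmul.
Proof. by move=> c x y; rewrite /lmul mulrDr scalerAr. Qed.

HB.instance Definition _ := GRing.isLinear.Build k C C *:%R lmul lmul_linear.

End LeftMultiplication.

Definition tens_mul_pure (y : tens A B) (a : A) (b : B) : tens A B :=
  tens_map (lmul a) (lmul b) y.

Lemma tens_mul_pure_bilinear y : bilinear_for *:%R *:%R (tens_mul_pure y).
Proof.
split=> [b|a] c x z /=; rewrite /tens_mul_pure;
  elim/tens_ind: y => [|u v|y y' IHy IHy'];
  rewrite ?linear0 ?addr0 ?linearD /= ?IHy ?IHy' 1?addrACA //.
- by rewrite !tens_mapE /= /lmul mulrDl -scalerAl linearPl.
- by rewrite !tens_mapE /= /lmul mulrDl -scalerAl linearPr.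
Qed.

HB.instance Definition _ y := bilinear_isBilinear.Build k A B (tens A B)
  *:%R *:%R (tens_mul_pure y) (tens_mul_pure_bilinear y).

Definition tens_one : tens A B := 1 \ox 1.
Definition tens_mul (x y : tens A B) : tens A B :=
  tens_lift (tens_mul_pure y) x.

Lemma tens_mulE a b a' b' :
  tens_mul (a \ox b) (a' \ox b') = (a * a') \ox (b * b').
Proof. by rewrite /tens_mul tens_liftE /= /tens_mul_pure tens_mapE. Qed.

Lemma tens_mulDl : left_distributive tens_mul +%R.
Proof. by move=> x y z; rewrite /tens_mul linearD. Qed.

Lemma tens_mulPr x c y z :
  tens_mul x (c *: y + z) = c *: tens_mul x y + tens_mul x z.
Proof.
rewrite /tens_mul; elim/tens_ind: x => [|a b|x x' IHx IHx'].
- by rewrite !linear0 addr0; reflexivity.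
- by rewrite !tens_liftE /= /tens_mul_pure linearP.
- by rewrite !linearD /= IHx IHx' addrACA.
Qed.

Lemma tens_mulDr : right_distributive tens_mul +%R.
Proof. by move=> x y z; have := tens_mulPr x 1 y z; rewrite !scale1r. Qed.

Lemma tens_mul0l x : tens_mul 0 x = 0.
Proof. by rewrite /tens_mul linear0. Qed.

Lemma tens_mul0r x : tens_mul x 0 = 0.
Proof.
by have := tens_mulPr x (-1) 0 0; rewrite !scaleN1r oppr0 addr0 addNr.
Qed.

Lemma tens_mulA : associative tens_mul.
Proof.
move=> x y z; elim/tens_ind: x => [|a b|x x' IHx IHx'].
- by rewrite !tens_mul0l.
- elim/tens_ind: y => [|a' b'|y y' IHy IHy'].
  + by rewrite tens_mul0l tens_mul0r tens_mul0l.
  + elim/tens_ind: z => [|a'' b''|z z' IHz IHz'].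
    * by rewrite !tens_mul0r.
    * by rewrite !tens_mulE !mulrA.
    * by rewrite !tens_mulDr IHz IHz'.
  + by rewrite tens_mulDl !tens_mulDr tens_mulDl IHy IHy'.
- by rewrite !tens_mulDl IHx IHx'.
Qed.

Lemma tens_mul1l : left_id tens_one tens_mul.
Proof.
move=> x; elim/tens_ind: x => [|a b|x y IHx IHy]; first exact: tens_mul0r.
  by rewrite tens_mulE !mul1r.
by rewrite tens_mulDr IHx IHy.
Qed.

Lemma tens_mul1r : right_id tens_one tens_mul.
Proof.
move=> x; elim/tens_ind: x => [|a b|x y IHx IHy]; first exact: tens_mul0l.
  by rewrite tens_mulE !mulr1.
by rewrite tens_mulDl IHx IHy.
Qed.

Definition scalar_mul (a b : k^o) : k^o := a * b.

Lemma scalar_mul_bilinear : bilinear_for *:%R *:%R scalar_mul.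
Proof.
split=> [b|a] c x y; rewrite /scalar_mul /=.
- by rewrite mulrDl scalerAl.
- by rewrite mulrDr scalerAr.
Qed.

HB.instance Definition _ := bilinear_isBilinear.Build k k^o k^o k^o
  *:%R *:%R scalar_mul scalar_mul_bilinear.

Lemma algebra_point (C : algType k) : exists l : {linear C -> k^o}, l 1 = 1.
Proof.
have alg_linear : linear (fun a : k^o => a *: (1 : C)).
  by move=> c x y; rewrite scalerDl scalerA.
pose iL := GRing.isLinear.Build k k^o C *:%R (fun a : k^o => a *: (1 : C))
  alg_linear.
pose i : {linear k^o -> C} := HB.pack (fun a : k^o => a *: (1 : C)) iL.
have i_inj : injective i.
  move=> a b /eqP; rewrite /= -subr_eq0 -scalerBl scaler_eq0 oner_eq0 orbF.
  by rewrite subr_eq0 => /eqP.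
have [l lK] := linear_extension (idfun : {linear k^o -> k^o}) i_inj.
by exists l; have := lK 1; rewrite /= scale1r.
Qed.

Lemma tens_one_neq0 : tens_one != 0.
Proof.
have [l l1] := algebra_point A; have [m m1] := algebra_point B.
apply/eqP => /(congr1 (tens_lift scalar_mul \o tens_map l m)) /=.
rewrite tens_mapE tens_liftE l1 m1 /= /scalar_mul mulr1 !linear0.
by move/eqP; rewrite oner_eq0.
Qed.

HB.instance Definition _ := GRing.Zmodule_isNzRing.Build (tens A B)
  tens_mulA tens_mul1l tens_mul1r tens_mulDl tens_mulDr tens_one_neq0.

Lemma tens_scalerAl (c : k) (x y : tens A B) : c *: (x * y) = (c *: x) * y.
Proof. by rewrite /GRing.mul /= /tens_mul linearZ. Qed.

HB.instance Definition _ :=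
  GRing.Lmodule_isLalgebra.Build k (tens A B) tens_scalerAl.

Lemma tens_scalerAr (c : k) (x y : tens A B) : c *: (x * y) = x * (c *: y).
Proof.
by have := tens_mulPr x c y 0; rewrite addr0 tens_mul0r addr0 => <-.
Qed.

HB.instance Definition _ :=
  GRing.Lalgebra_isAlgebra.Build k (tens A B) tens_scalerAr.

Lemma tens_pureM a b a' b' :
  (a \ox b : tens A B) * (a' \ox b') = (a * a') \ox (b * b').
Proof. exact: tens_mulE. Qed.

End TensorAlgebra.

Section TensorMapMorphism.
Variables (k : fieldType) (A A' B B' : algType k).
Variables (f : {lrmorphism A -> A'}) (g : {lrmorphism B -> B'}).

Lemma tens_map_monoid_morphism : monoid_morphism (tens_map f g).
Proof.
split=> [|x y]; first by rewrite [LHS]tens_mapE !rmorph1.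
elim/tens_ind: x => [|a b|x x' IHx IHx'].
- by rewrite mul0r !linear0 mul0r.
- elim/tens_ind: y => [|a' b'|y y' IHy IHy'].
  + by rewrite mulr0 !linear0 mulr0.
  + by rewrite tens_pureM !tens_mapE tens_pureM !rmorphM.
  + by rewrite mulrDr !linearD /= IHy IHy' mulrDr.
- by rewrite mulrDl !linearD /= IHx IHx' mulrDl.
Qed.

HB.instance Definition _ := GRing.isMonoidMorphism.Build
  (tens A B) (tens A' B') (tens_map f g) tens_map_monoid_morphism.

End TensorMapMorphism.

HB.mixin Record Algebra_isBialgebra (k : fieldType) A of GRing.Algebra k A := {
  comul : {lrmorphism A -> tens A A};
  counit : {lrmorphism A -> k^o};
  comulA : forall x : A,
    tens_assoc (tens_map comul idfun (comul x)) =
    tens_map idfun comul (comul x);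
  counitl : forall x : A,
    tens_map counit idfun (comul x) = (1 : k^o) \ox x;
  counitr : forall x : A,
    tens_map idfun counit (comul x) = x \ox (1 : k^o)
}.

#[short(type="bialgType")]
HB.structure Definition Bialgebra (k : fieldType) :=
  {A of GRing.Algebra k A & Algebra_isBialgebra k A}.

(* x |-> x_(1) (x) (x_(2) (x) x_(3)) *)
Definition comul2 (k : fieldType) (A : bialgType k) (x : A) :
  tens A (tens A A) := tens_map idfun comul (comul x).

Record bialg_hom (k : fieldType) (A B : bialgType k) := BialgHom {
  bialg_fun :> {lrmorphism A -> B};
  bialg_hom_comul : forall x, comul (bialg_fun x) =
    tens_map bialg_fun bialg_fun (comul x);
  bialg_hom_counit : forall x, counit (bialg_fun x) = counit x
}.

Section BialgHom.
Variable k : fieldType.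

Lemma lrmorphism_eq (A B : algType k) (f g : {lrmorphism A -> B}) :
  f =1 g -> f = g.
Proof.
case: f g => [f cf] [g cg] /= /funext fg; move: cg; rewrite -fg => cg.
case: cf cg => [[f1] [f2] [f3]] [[g1] [g2] [g3]].
rewrite (Prop_irrelevance f1 g1) (Prop_irrelevance f2 g2).
by rewrite (Prop_irrelevance f3 g3).
Qed.

Lemma bialg_hom_eq (A B : bialgType k) (f g : bialg_hom A B) :
  f =1 g -> f = g.
Proof.
case: f g => [f fD fe] [g gD ge] /= /lrmorphism_eq fg.
move: gD ge; rewrite -fg => gD ge.
by congr BialgHom; exact: Prop_irrelevance.
Qed.

Lemma bialg_id_comul (A : bialgType k) (x : A) :
  comul (idfun x) = tens_map idfun idfun (comul x).
Proof. by rewrite tens_map_id. Qed.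

Definition bialg_id (A : bialgType k) : bialg_hom A A :=
  BialgHom (@bialg_id_comul A) (fun=> erefl).

Section Comp.
Variables (A B C : bialgType k) (g : bialg_hom B C) (f : bialg_hom A B).

Let gf : {lrmorphism A -> C} := bialg_fun g \o bialg_fun f.

Lemma bialg_comp_comul x : comul (gf x) = tens_map gf gf (comul x).
Proof.
rewrite /= !bialg_hom_comul [LHS]tens_map_comp.
exact: eq_tens_map.
Qed.

Lemma bialg_comp_counit x : counit (gf x) = counit x.
Proof. by rewrite /= !bialg_hom_counit. Qed.

Definition bialg_comp : bialg_hom A C :=
  BialgHom bialg_comp_comul bialg_comp_counit.

End Comp.

End BialgHom.

(* Both index categories and the category of bialgebras are of this type, so an
   index category J need not be small; smallness only serves to ensure that
   products indexed by the objects or the arrows of J exist. *)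
Record category := Category {
  obj :> Type;
  hom : obj -> obj -> Type;
  catid : forall a, hom a a;
  catcomp : forall a b c, hom b c -> hom a b -> hom a c;
  catcompA : forall a b c d (h : hom c d) (g : hom b c) (f : hom a b),
    catcomp h (catcomp g f) = catcomp (catcomp h g) f;
  catcomp1f : forall a b (f : hom a b), catcomp (catid b) f = f;
  catcompf1 : forall a b (f : hom a b), catcomp f (catid a) = f
}.

Arguments hom {_} a b.
Arguments catid {_} a.

Notation "g \oc f" := (catcomp g f) (at level 50, format "g  \oc  f").

Record functor (C D : category) := Functor {
  fobj :> C -> D;
  fmap : forall a b, hom a b -> hom (fobj a) (fobj b);
  fmap_id : forall a, fmap (catid a) = catid (fobj a);
  fmap_comp : forall a b c (g : hom b c) (f : hom a b),
    fmap (g \oc f) = fmap g \oc fmap f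
}.

Arguments fmap {_ _} f {_ _} u : rename.

(* The set Hom(J) of all arrows of J. *)
Record arrow (J : category) := Arrow {
  dom : J;
  cod : J;
  arr :> hom dom cod
}.

Definition is_product (C : category) (I : Type) (X : I -> C)
    (P : C) (p : forall i, hom P (X i)) :=
  forall (Y : C) (q : forall i, hom Y (X i)),
    exists! h : hom Y P, forall i, p i \oc h = q i.

Definition is_cone (J C : category) (F : functor J C)
    (Y : C) (psi : forall j, hom Y (F j)) :=
  forall (i j : J) (u : hom i j), fmap F u \oc psi i = psi j.

Definition is_limit (J C : category) (F : functor J C)
    (L : C) (phi : forall j, hom L (F j)) :=
  is_cone phi /\
  forall (Y : C) (psi : forall j, hom Y (F j)), is_cone psi ->
    exists! h : hom Y L, forall j, phi j \oc h = psi j.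

Section BiAlg.
Variable k : fieldType.

Lemma bialg_compA (A B C D : bialgType k) (h : bialg_hom C D)
    (g : bialg_hom B C) (f : bialg_hom A B) :
  bialg_comp h (bialg_comp g f) = bialg_comp (bialg_comp h g) f.
Proof. exact: bialg_hom_eq. Qed.

Lemma bialg_comp1f (A B : bialgType k) (f : bialg_hom A B) :
  bialg_comp (bialg_id B) f = f.
Proof. exact: bialg_hom_eq. Qed.

Lemma bialg_compf1 (A B : bialgType k) (f : bialg_hom A B) :
  bialg_comp f (bialg_id A) = f.
Proof. exact: bialg_hom_eq. Qed.

Definition BiAlg : category :=
  Category bialg_compA bialg_comp1f bialg_compf1.

End BiAlg.

(* The x such that x_(1) (x) f x_(2) (x) x_(3) = x_(1) (x) g x_(2) (x) x_(3). *)
Definition sweedler_equalizer (k : fieldType) (A B : bialgType k)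
    (f g : bialg_hom A B) : set A :=
  [set x | tens_map idfun (tens_map f idfun) (comul2 x) =
           tens_map idfun (tens_map g idfun) (comul2 x)]%classic.

Section SubBialgebra.
Variables (k : fieldType) (B : bialgType k).

(* The last field says that comul maps the subspace D to the image of D (x) D
   in B (x) B. *)
Record subbialg := SubBialg {
  subbialg_set :> set B;
  subbialg1 : subbialg_set 1;
  subbialgP : forall (a : k) x y,
    subbialg_set x -> subbialg_set y -> subbialg_set (a *: x + y);
  subbialgM : forall x y,
    subbialg_set x -> subbialg_set y -> subbialg_set (x * y);
  subbialg_comul : forall x, subbialg_set x ->
    exists2 s : seq (B * B),
      {in s, forall p, subbialg_set p.1 /\ subbialg_set p.2} &
      comul x = \sum_(p <- s) p.1 \ox p.2
}.

Variable D : subbialg.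

Definition subbialg_pred : {pred B} := fun x => `[< subbialg_set D x >].

Lemma subbialg_predP x : x \in subbialg_pred <-> subbialg_set D x.
Proof. by split=> [/asboolP|Dx]; [|apply/asboolP]. Qed.

Lemma subbialg_pred_subalg_closed : subalg_closed subbialg_pred.
Proof.
split=> [|a x y|x y].
- exact/asboolP/subbialg1.
- by move=> /asboolP Dx /asboolP Dy; apply/asboolP/subbialgP.
- by move=> /asboolP Dx /asboolP Dy; apply/asboolP/subbialgM.
Qed.

HB.instance Definition _ := GRing.isSubalgClosed.Build k B subbialg_pred
  (GRing.subalg_closed_semi subbialg_pred_subalg_closed).

Record subbialg_sort := SubBialgElt {
  subbialg_val : B;
  subbialg_valP : subbialg_val \in subbialg_pred
}.

HB.instance Definition _ := [isSub for subbialg_val].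
HB.instance Definition _ := [Choice of subbialg_sort by <:].
HB.instance Definition _ := [SubChoice_isSubAlgebra of subbialg_sort by <:].

Local Notation S := subbialg_sort.

Definition subbialg_incl (x : S) : B := subbialg_val x.

Lemma subbialg_incl_linear : linear subbialg_incl.
Proof. by move=> a x y; exact: (linearP (\val : {linear S -> B})). Qed.

Lemma subbialg_incl_monoid_morphism : monoid_morphism subbialg_incl.
Proof. exact: (rmorphism_monoidP (\val : {rmorphism S -> B})). Qed.

HB.instance Definition _ :=
  GRing.isLinear.Build k S B *:%R subbialg_incl subbialg_incl_linear.
HB.instance Definition _ := GRing.isMonoidMorphism.Build S B subbialg_incl
  subbialg_incl_monoid_morphism.

Lemma subbialg_incl_inj : injective subbialg_incl.
Proof. exact: val_inj. Qed.

Local Notation incl2 := (tens_map subbialg_incl subbialg_incl).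

Lemma subbialg_comul_exists (x : S) :
  exists t : tens S S, incl2 t = comul (subbialg_incl x).
Proof.
have /subbialg_comul[s sD ->] : subbialg_set D (subbialg_incl x).
  exact/subbialg_predP/valP.
elim: s sD => [|p s IHs] sD.
  by exists 0; rewrite big_nil linear0.
have [t tE] := IHs (fun q qs => sD q (mem_behead (s := p :: s) qs)).
have [/subbialg_predP p1 /subbialg_predP p2] := sD p (mem_head _ _).
exists (SubBialgElt p1 \ox SubBialgElt p2 + t).
by rewrite big_cons linearD /= tE tens_mapE.
Qed.

(* The restriction of the comultiplication of B, unique since
   D (x) D -> B (x) B is injective. *)
Definition subbialg_sort_comul (x : S) : tens S S :=
  projT1 (cid (subbialg_comul_exists x)).

Lemma subbialg_sort_comulE x :
  incl2 (subbialg_sort_comul x) = comul (subbialg_incl x).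
Proof. exact: projT2 (cid (subbialg_comul_exists x)). Qed.

Lemma incl2_inj : injective incl2.
Proof. by apply: tens_map_inj; exact: subbialg_incl_inj. Qed.

Lemma subbialg_sort_comul_linear : linear subbialg_sort_comul.
Proof.
move=> a x y; apply: incl2_inj.
by rewrite [RHS]linearP /= !subbialg_sort_comulE subbialg_incl_linear linearP.
Qed.

Lemma subbialg_sort_comul_monoid_morphism :
  monoid_morphism subbialg_sort_comul.
Proof.
split=> [|x y]; apply: incl2_inj.
  by rewrite subbialg_sort_comulE !rmorph1; reflexivity.
by rewrite subbialg_sort_comulE [RHS]rmorphM /= !subbialg_sort_comulE !rmorphM.
Qed.

HB.instance Definition _ := GRing.isLinear.Build k S (tens S S) *:%R
  subbialg_sort_comul subbialg_sort_comul_linear.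
HB.instance Definition _ := GRing.isMonoidMorphism.Build S (tens S S)
  subbialg_sort_comul subbialg_sort_comul_monoid_morphism.

Definition subbialg_sort_counit : S -> k^o := counit \o subbialg_incl.

HB.instance Definition _ := GRing.LRMorphism.on subbialg_sort_counit.

Lemma subbialg_sort_comulA x :
  tens_assoc (tens_map subbialg_sort_comul idfun (subbialg_sort_comul x)) =
  tens_map idfun subbialg_sort_comul (subbialg_sort_comul x).
Proof.
have incl3_inj : injective (tens_map subbialg_incl incl2).
  by apply: tens_map_inj; [exact: subbialg_incl_inj|exact: incl2_inj].
apply: incl3_inj; rewrite -tens_assoc_nat.
transitivity (tens_assoc (tens_map comul idfun
  (incl2 (subbialg_sort_comul x)))).
  congr tens_assoc; rewrite [LHS]tens_map_comp [RHS]tens_map_comp.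
  by apply: eq_tens_map => // y; exact: subbialg_sort_comulE.
rewrite subbialg_sort_comulE comulA -subbialg_sort_comulE.
rewrite [LHS]tens_map_comp [RHS]tens_map_comp.
by apply: eq_tens_map => // y; rewrite /= subbialg_sort_comulE.
Qed.

Lemma subbialg_sort_counitl x :
  tens_map subbialg_sort_counit idfun (subbialg_sort_comul x) =
  (1 : k^o) \ox x.
Proof.
have incl1_inj :
    injective (tens_map (idfun : {linear k^o -> k^o}) subbialg_incl).
  by apply: tens_map_inj => //; exact: subbialg_incl_inj.
apply: incl1_inj; rewrite [LHS]tens_map_comp tens_mapE /= -counitl.
rewrite -subbialg_sort_comulE [RHS]tens_map_comp; exact: eq_tens_map.
Qed.

Lemma subbialg_sort_counitr x :
  tens_map idfun subbialg_sort_counit (subbialg_sort_comul x) =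
  x \ox (1 : k^o).
Proof.
have incl1_inj :
    injective (tens_map subbialg_incl (idfun : {linear k^o -> k^o})).
  by apply: tens_map_inj => //; exact: subbialg_incl_inj.
apply: incl1_inj; rewrite [LHS]tens_map_comp tens_mapE /= -counitr.
rewrite -subbialg_sort_comulE [RHS]tens_map_comp; exact: eq_tens_map.
Qed.

HB.instance Definition _ := Algebra_isBialgebra.Build k S
  subbialg_sort_comulA subbialg_sort_counitl subbialg_sort_counitr.

Definition subbialg_bialg : bialgType k := S.

Definition subbialg_inclusion : bialg_hom subbialg_bialg B :=
  @BialgHom k subbialg_bialg B subbialg_incl
    (fun x => esym (subbialg_sort_comulE x)) (fun x => erefl).

End SubBialgebra.

(* Main.v *)
Require Import Defs.
From HB Require Import structures.
From mathcomp Require Import all_boot ssralg sesquilinear.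
From mathcomp Require Import boolp classical_sets.

Set Implicit Arguments.
Unset Strict Implicit.
Unset Printing Implicit Defensive.

Import GRing.Theory.

Local Open Scope ring_scope.

(** Write s_f x for the tensor x_(1) (x) f x_(2) (x) x_(3), so that D is the
    equalizer of the linear maps s_f and s_g.

    D is a subbialgebra.  Since s_f and s_g are algebra maps, D is a subalgebra.
    Coassociativity identifies (s_f (x) id) o Delta with
    (id (x) id (x) Delta) o s_f, and (id (x) s_f) o Delta with
    (Delta (x) id (x) id) o s_f ([sandwich_comull], [sandwich_comulr]); hence
    for x in D the tensor Delta x is killed by s_f - s_g on either side.  Over a
    field, a tensor that a linear map h kills on both sides lies in
    ker h (x) ker h ([tens_ker]), so Delta x is in D (x) D.

    D is the limit.  Two properties of D suffice:
    - f and g agree on D, because the counit applied to the two outer factors of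
      s_f x returns f x ([sweedler_equalizer_eq]);
    - if f o h = g o h for a bialgebra map h, then h takes its values in D,
      because s_f (h y) is h y_(1) (x) f (h y_(2)) (x) h y_(3)
      ([sweedler_equalizer_range]).
    The first makes the restricted projections a cone, as F(u) o p_i and p_j are
    q_u o g and q_u o f.  For the universal property, a cone psi induces h into
    the product of the F(j); the maps f o h and g o h have the same components
    psi_(cod u), so they are equal and h corestricts to D.  The
    corestriction is unique since h is and the inclusion of D is injective. *)

(** * Kernels and tensor products *)

Section Kernel.
Variables (k : fieldType) (V W : lmodType k) (h : {linear V -> W}).

Definition ker_pred : {pred V} := fun x => h x == 0.

Lemma ker_predP x : reflect (h x = 0) (x \in ker_pred).
Proof. exact: eqP. Qed.

Lemma ker_pred_submod_closed : submod_closed ker_pred.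
Proof.
split=> [|a x y /ker_predP hx /ker_predP hy]; apply/ker_predP.
  exact: linear0.
by rewrite linearP hx hy scaler0 addr0.
Qed.

HB.instance Definition _ := GRing.isSubmodClosed.Build k V ker_pred
  (GRing.submod_closed_semi ker_pred_submod_closed).

(** A module in its own right, so that [linear_extension] applies to maps
    defined on the kernel only. *)
Record ker_sort := KerElt { ker_val : V; ker_valP : ker_val \in ker_pred }.

HB.instance Definition _ := [isSub for ker_val].
HB.instance Definition _ := [Choice of ker_sort by <:].
HB.instance Definition _ := [SubChoice_isSubLmodule of ker_sort by <:].

Definition ker_incl : {linear ker_sort -> V} := \val.

Lemma ker_inclP x : h (ker_incl x) = 0.
Proof. exact/ker_predP/valP. Qed.

Lemma ker_incl_inj : injective ker_incl.
Proof. exact: val_inj. Qed.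

Lemma ker_incl_lift v : h v = 0 -> exists x, ker_incl x = v.
Proof. by move=> /ker_predP hv; exists (KerElt hv). Qed.

End Kernel.

(** Extending the identity of ker h gives a projection onto ker h, and the
    kernel of that projection is a complement of ker h on which h is injective;
    c extends the inverse of h on that complement.  The point is that id - c o h
    is then a projection onto ker h. *)
Lemma linear_quasi_inverse (k : fieldType) (V W : lmodType k)
    (h : {linear V -> W}) :
  exists c : {linear W -> V}, forall x, h (c (h x)) = h x.
Proof.
have [r rK] := linear_extension (idfun : {linear ker_sort h -> ker_sort h})
  (@ker_incl_inj _ _ _ h).
pose proj : {linear V -> V} := ker_incl h \o r.
have hproj x : h (proj x) = 0 by exact: ker_inclP.
have proj_id x : h x = 0 -> proj x = x.
  by move=> /ker_incl_lift[y <-]; rewrite /proj /= rK.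
pose i : {linear ker_sort proj -> W} := h \o ker_incl proj.
have i_inj : injective i.
  move=> x y ixy; apply/eqP; rewrite -subr_eq0; apply/eqP/ker_incl_inj.
  have ixy0 : i (x - y) = 0 by rewrite linearB ixy subrr.
  by rewrite -(proj_id _ ixy0) ker_inclP linear0.
have [c cK] := linear_extension (ker_incl proj) i_inj.
exists c => x.
have [|y yE] := @ker_incl_lift _ _ _ proj (x - proj x).
  by rewrite linearB (proj_id _ (hproj x)) subrr.
have <- : h (x - proj x) = h x by rewrite linearB hproj subr0.
by rewrite -yE; congr (h _); exact: cK.
Qed.

Section TensMapSub.
Variables (R : comNzRingType) (V V' W W' : lmodType R).

Lemma tens_mapBl (f f' : {linear V -> V'}) (g : {linear W -> W'}) x :
  tens_map (f \- f') g x = tens_map f g x - tens_map f' g x.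
Proof.
move: x; apply: (tens_eq_linear (g := tens_map f g \- tens_map f' g)) => v w.
by rewrite /= !tens_mapE linearBl.
Qed.

Lemma tens_mapBr (f : {linear V -> V'}) (g g' : {linear W -> W'}) x :
  tens_map f (g \- g') x = tens_map f g x - tens_map f g' x.
Proof.
move: x; apply: (tens_eq_linear (g := tens_map f g \- tens_map f g')) => v w.
by rewrite /= !tens_mapE linearBr.
Qed.

End TensMapSub.

(** The identity (ker h (x) V) meet (V (x) ker h) = ker h (x) ker h.  If e is a
    projection onto ker h of the form id - c o h, then by the hypotheses e (x) id
    and id (x) e fix t, hence so does e (x) e, and e (x) e sends every pure
    tensor into ker h (x) ker h. *)
Lemma tens_ker (k : fieldType) (V W : lmodType k) (h : {linear V -> W})
    (t : tens V V) :
    tens_map h idfun t = 0 -> tens_map idfun h t = 0 ->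
  exists2 s : seq (V * V),
    {in s, forall p, h p.1 = 0 /\ h p.2 = 0} & t = \sum_(p <- s) p.1 \ox p.2.
Proof.
move=> htl htr.
have [c cK] := linear_quasi_inverse h.
pose e : {linear V -> V} := idfun \- (c \o h).
have he x : h (e x) = 0 by rewrite linearB [h ((c \o h) x)]cK subrr.
have el : tens_map e idfun t = t.
  rewrite tens_mapBl tens_map_id -[RHS]subr0; congr (_ - _).
  transitivity (tens_map c idfun (tens_map h idfun t)).
    by rewrite [RHS]tens_map_comp; exact: eq_tens_map.
  by rewrite htl linear0.
have er : tens_map idfun e t = t.
  rewrite tens_mapBr tens_map_id -[RHS]subr0; congr (_ - _).
  transitivity (tens_map idfun c (tens_map idfun h t)).
    by rewrite [RHS]tens_map_comp; exact: eq_tens_map.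
  by rewrite htr linear0.
have -> : t = tens_map e e t.
  rewrite -{1}el -{1}er [LHS]tens_map_comp; exact: eq_tens_map.
elim/tens_ind: (t) => [|v w|x y [s sP xE] [s' s'P yE]].
- by exists [::]; rewrite ?big_nil ?linear0.
- exists [:: (e v, e w)]; last by rewrite big_seq1 tens_mapE.
  by move=> p; rewrite inE => /eqP ->; split; exact: he.
- exists (s ++ s'); last by rewrite big_cat linearD /= -xE -yE.
  by move=> p; rewrite mem_cat => /orP[/sP|/s'P].
Qed.

(** * Associativity and unit of the tensor product *)

Section TensSwap.
Variables (R : comNzRingType) (V W : lmodType R).

Definition tens_swap_pure (v : V) (w : W) : tens W V := w \ox v.

Lemma tens_swap_pure_bilinear : bilinear_for *:%R *:%R tens_swap_pure.
Proof.
split=> [w|v] a x y /=; rewrite /tens_swap_pure; first by rewrite linearPr.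
by rewrite linearPl.
Qed.

HB.instance Definition _ := bilinear_isBilinear.Build R V W (tens W V)
  *:%R *:%R tens_swap_pure tens_swap_pure_bilinear.

Definition tens_swap : tens V W -> tens W V := tens_lift tens_swap_pure.

HB.instance Definition _ := GRing.Linear.on tens_swap.

Lemma tens_swapE v w : tens_swap (v \ox w) = w \ox v.
Proof. exact: tens_liftE. Qed.

End TensSwap.

(** The associativity constraint in the other direction is this one conjugated
    by swaps, which avoids building it from trilinear maps. *)
Lemma tens_assoc_inj (R : comNzRingType) (U V W : lmodType R) :
  injective (@tens_assoc R U V W).
Proof.
pose unassoc : {linear tens U (tens V W) -> tens (tens U V) W} :=
  @tens_swap R W (tens U V) \o tens_map idfun (@tens_swap R V U)
  \o @tens_assoc R W V U \o tens_map (@tens_swap R V W) idfun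
  \o @tens_swap R U (tens V W).
apply: (can_inj (g := unassoc)).
apply: (tens_eq_linear3 (f := unassoc \o @tens_assoc R U V W)
  (g := idfun)) => u v w.
by rewrite /= tens_assocE tens_swapE tens_mapE /= tens_swapE tens_assocE
  tens_mapE /= !tens_swapE.
Qed.

Lemma pure1_inj (R : comNzRingType) (V : lmodType R) :
  injective (fun v : V => v \ox (1 : R^o)).
Proof.
pose act (v : V) (a : R^o) : V := a *: v.
have act_bilinear : bilinear_for *:%R *:%R act.
  split=> [a|v] c x y /=; rewrite /act.
  - by rewrite scalerDr !scalerA mulrC.
  - by rewrite scalerDl scalerA.
pose actB := bilinear_isBilinear.Build R V R^o V *:%R *:%R act act_bilinear.
pose actb : {bilinear V -> R^o -> V} := HB.pack act actB.
apply: (can_inj (g := tens_lift actb)) => v.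
by rewrite tens_liftE /= /act scale1r.
Qed.

(** A form of [tens_map_comp] in which the composites may be any maps that agree
    with them pointwise. *)
Lemma tens_map_compE (R : comNzRingType) (V V' V'' W W' W'' : lmodType R)
    (f' : {linear V' -> V''}) (f : {linear V -> V'}) (f'' : {linear V -> V''})
    (g' : {linear W' -> W''}) (g : {linear W -> W'}) (g'' : {linear W -> W''})
    (x : tens V W) :
  (forall v, f' (f v) = f'' v) -> (forall w, g' (g w) = g'' w) ->
  tens_map f' g' (tens_map f g x) = tens_map f'' g'' x.
Proof.
by move=> fE gE; rewrite [LHS]tens_map_comp; apply: eq_tens_map.
Qed.

(** * The map x |-> x_(1) (x) f x_(2) (x) x_(3) *)

Section Sandwich.
Variables (k : fieldType) (A B : bialgType k) (f : {linear A -> B}).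

(** x |-> f x_(1) (x) x_(2) *)
Definition half_sandwich (x : A) : tens B A := tens_map f idfun (comul x).

Lemma half_sandwich_linear : linear half_sandwich.
Proof. by move=> a x y; rewrite /half_sandwich !linearP. Qed.

HB.instance Definition _ := GRing.isLinear.Build k A (tens B A) *:%R
  half_sandwich half_sandwich_linear.

Definition sandwich (x : A) : tens A (tens B A) :=
  tens_map idfun half_sandwich (comul x).

Lemma sandwich_linear : linear sandwich.
Proof. by move=> a x y; rewrite /sandwich !linearP. Qed.

HB.instance Definition _ := GRing.isLinear.Build k A (tens A (tens B A)) *:%R
  sandwich sandwich_linear.

Lemma sandwichE x : sandwich x = tens_map idfun (tens_map f idfun) (comul2 x).
Proof.
by rewrite /comul2 (tens_map_compE (f'' := idfun) (g'' := half_sandwich)).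
Qed.

(** By coassociativity, both sides are
    x_(1) (x) (x_(2) (x) (f x_(3) (x) x_(4))). *)
Lemma sandwich_comulr x :
  tens_map idfun sandwich (comul x) =
  tens_assoc (tens_map comul idfun (sandwich x)).
Proof.
transitivity (tens_assoc (tens_map (tens_map idfun idfun) half_sandwich
    (tens_map comul idfun (comul x)))).
  rewrite tens_assoc_nat comulA.
  by rewrite (tens_map_compE (f'' := idfun) (g'' := sandwich)).
congr tens_assoc; rewrite /sandwich.
rewrite (tens_map_compE (f'' := comul) (g'' := half_sandwich)) //.
  by rewrite (tens_map_compE (f'' := comul) (g'' := half_sandwich)).
by move=> y; exact: tens_map_id.
Qed.

(** By coassociativity, both sides are f x_(1) (x) (x_(2) (x) x_(3)). *)
Lemma half_sandwich_comul x :
  tens_assoc (tens_map half_sandwich idfun (comul x)) =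
  tens_map idfun comul (half_sandwich x).
Proof.
rewrite -(tens_map_compE (f' := tens_map f idfun) (f := comul)
  (f'' := half_sandwich) (g' := idfun) (g := idfun)) //.
rewrite tens_assoc_nat comulA.
rewrite (tens_map_compE (f'' := f) (g'' := comul)) //; last first.
  by move=> y; exact: tens_map_id.
by rewrite (tens_map_compE (f'' := f) (g'' := comul)).
Qed.

(** By coassociativity, both sides are
    x_(1) (x) (f x_(2) (x) (x_(3) (x) x_(4))).  Two reassociations are needed to
    bring the left factor s_f x of the left-hand side to this bracketing. *)
Lemma sandwich_comull x :
  tens_map idfun (@tens_assoc k B A A)
    (tens_assoc (tens_map sandwich idfun (comul x))) =
  tens_map idfun (tens_map idfun comul) (sandwich x).
Proof.
rewrite -(tens_map_compE (f' := tens_map idfun half_sandwich) (f := comul)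
  (f'' := sandwich) (g' := idfun) (g := idfun)) //.
rewrite tens_assoc_nat comulA.
pose m : {linear A -> _} :=
  tens_map (idfun : {linear B -> B}) comul \o half_sandwich.
rewrite [RHS](tens_map_compE (f'' := idfun) (g'' := m)) //.
pose m' : {linear A -> _} :=
  tens_map half_sandwich (idfun : {linear A -> A}) \o comul.
rewrite [X in tens_map _ _ X](tens_map_compE (f'' := idfun) (g'' := m')) //.
by apply: tens_map_compE => // y; exact: half_sandwich_comul.
Qed.

Lemma half_sandwich_counit x :
  tens_map idfun counit (half_sandwich x) = f x \ox (1 : k^o).
Proof.
rewrite -[RHS](tens_mapE f idfun) -counitr.
rewrite (tens_map_compE (f'' := f) (g'' := counit)) //.
by rewrite (tens_map_compE (f'' := f) (g'' := counit)).
Qed.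

Lemma sandwich_counit x :
  tens_map counit (tens_map idfun counit) (sandwich x) =
  (1 : k^o) \ox (f x \ox (1 : k^o)).
Proof.
pose m : {linear A -> _} :=
  tens_map (idfun : {linear B -> B}) counit \o half_sandwich.
rewrite (tens_map_compE (f'' := counit) (g'' := m)) //.
rewrite -half_sandwich_counit -[RHS](tens_mapE idfun m) -counitl.
by rewrite (tens_map_compE (f'' := counit) (g'' := m)).
Qed.

Lemma half_sandwich_hom (Y : bialgType k) (h : bialg_hom Y A) y :
  half_sandwich (h y) = tens_map (f \o h) h (comul y).
Proof. by rewrite /half_sandwich bialg_hom_comul; exact: tens_map_compE. Qed.

Lemma sandwich_hom (Y : bialgType k) (h : bialg_hom Y A) y :
  sandwich (h y) = tens_map h (tens_map (f \o h) h \o comul) (comul y).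
Proof.
rewrite /sandwich bialg_hom_comul; apply: tens_map_compE => // z.
exact: half_sandwich_hom.
Qed.

End Sandwich.

(** By [sandwich_comull], s_f x determines the tensor on the left up to two
    reassociations, and these are injective. *)
Lemma sandwich_eq_comul (k : fieldType) (A B : bialgType k)
    (f g : {linear A -> B}) x :
  sandwich f x = sandwich g x ->
  tens_map (sandwich f) idfun (comul x) = tens_map (sandwich g) idfun (comul x).
Proof.
move=> fgx.
have assoc_inj : injective (tens_map (idfun : {linear A -> A})
    (@tens_assoc k B A A)).
  by apply: tens_map_inj; [exact: inj_id|exact: tens_assoc_inj].
apply: (@tens_assoc_inj k A (tens B A) A); apply: assoc_inj.
by rewrite [LHS]sandwich_comull [RHS]sandwich_comull fgx.
Qed.

Section SandwichMorphism.
Variables (k : fieldType) (A B : bialgType k) (f : {lrmorphism A -> B}).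

Lemma half_sandwich_monoid_morphism : monoid_morphism (half_sandwich f).
Proof.
split=> [|x y]; first by rewrite /half_sandwich !rmorph1.
by rewrite /half_sandwich !rmorphM.
Qed.

HB.instance Definition _ := GRing.isMonoidMorphism.Build A (tens B A)
  (half_sandwich f) half_sandwich_monoid_morphism.

Lemma sandwich_monoid_morphism : monoid_morphism (sandwich f).
Proof.
split=> [|x y]; first by rewrite /sandwich !rmorph1.
by rewrite /sandwich !rmorphM.
Qed.

End SandwichMorphism.

(** * The subbialgebra D *)

Section SweedlerSubbialgebra.
Variables (k : fieldType) (A B : bialgType k) (f g : bialg_hom A B).

Let fg : {linear A -> tens A (tens B A)} := sandwich f \- sandwich g.

Lemma sweedler_equalizerP x :
  sweedler_equalizer f g x <-> sandwich f x = sandwich g x.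
Proof. by rewrite !sandwichE. Qed.

Lemma sweedler_equalizer1 : sweedler_equalizer f g 1.
Proof.
by apply/sweedler_equalizerP; rewrite !(sandwich_monoid_morphism _).1.
Qed.

Lemma sweedler_equalizer_linear (a : k) x y : sweedler_equalizer f g x ->
  sweedler_equalizer f g y -> sweedler_equalizer f g (a *: x + y).
Proof.
move=> /sweedler_equalizerP xD /sweedler_equalizerP yD.
by apply/sweedler_equalizerP; rewrite !sandwich_linear xD yD.
Qed.

Lemma sweedler_equalizerM x y : sweedler_equalizer f g x ->
  sweedler_equalizer f g y -> sweedler_equalizer f g (x * y).
Proof.
move=> /sweedler_equalizerP xD /sweedler_equalizerP yD.
by apply/sweedler_equalizerP; rewrite !(sandwich_monoid_morphism _).2 xD yD.
Qed.

Lemma sweedler_equalizer_comul x : sweedler_equalizer f g x ->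
  exists2 s : seq (A * A),
    {in s, forall p, sweedler_equalizer f g p.1 /\ sweedler_equalizer f g p.2} &
    comul x = \sum_(p <- s) p.1 \ox p.2.
Proof.
move=> /sweedler_equalizerP xD.
have fg0 y : fg y = 0 -> sweedler_equalizer f g y.
  by move=> /eqP; rewrite subr_eq0 => /eqP ?; apply/sweedler_equalizerP.
have [||s sP sE] := @tens_ker _ _ _ fg (comul x).
- by rewrite tens_mapBl (sandwich_eq_comul xD) subrr.
- by rewrite tens_mapBr !sandwich_comulr xD subrr.
- by exists s => // p /sP[p1 p2]; split; exact: fg0.
Qed.

Definition sweedler_subbialg : subbialg A :=
  SubBialg sweedler_equalizer1 sweedler_equalizer_linear sweedler_equalizerM
    sweedler_equalizer_comul.

Lemma sweedler_equalizer_eq x : sweedler_equalizer f g x -> f x = g x.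
Proof.
move=> /sweedler_equalizerP xD; apply: pure1_inj; apply: pure1_inj.
have := congr1 (@tens_swap _ _ _ \o tens_map counit (tens_map idfun counit)) xD.
by rewrite /= !sandwich_counit !tens_swapE.
Qed.

Lemma sweedler_equalizer_range (Y : bialgType k) (h : bialg_hom Y A) :
  (forall y, f (h y) = g (h y)) -> forall y, sweedler_equalizer f g (h y).
Proof.
move=> fgh y; apply/sweedler_equalizerP.
rewrite !sandwich_hom.
by apply: eq_tens_map => // z; apply: eq_tens_map => // {}z; exact: fgh.
Qed.

End SweedlerSubbialgebra.

(** * Corestriction and the limit *)

Section Corestriction.
Variables (k : fieldType) (Y A : bialgType k) (D : subbialg A).
Variables (h : bialg_hom Y A) (hD : forall y, subbialg_set D (h y)).

Definition corestrict (y : Y) : subbialg_bialg D :=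
  SubBialgElt ((subbialg_predP D (h y)).2 (hD y)).

Lemma corestrict_linear : linear corestrict.
Proof.
move=> a x y; apply: subbialg_incl_inj.
by rewrite [RHS]linearP; exact: (linearP h).
Qed.

Lemma corestrict_monoid_morphism : monoid_morphism corestrict.
Proof.
split=> [|x y]; apply: subbialg_incl_inj.
  by rewrite [RHS]rmorph1; exact: (rmorph1 h).
by rewrite [RHS]rmorphM; exact: (rmorphM h).
Qed.

HB.instance Definition _ := GRing.isLinear.Build k Y (subbialg_bialg D) *:%R
  corestrict corestrict_linear.
HB.instance Definition _ := GRing.isMonoidMorphism.Build Y (subbialg_bialg D)
  corestrict corestrict_monoid_morphism.

Lemma corestrict_comul y :
  comul (corestrict y) = tens_map corestrict corestrict (comul y).
Proof.
apply: incl2_inj; rewrite [LHS]subbialg_sort_comulE.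
rewrite [RHS]tens_map_comp; exact: (bialg_hom_comul h).
Qed.

Lemma corestrict_counit y : counit (corestrict y) = counit y.
Proof. exact: (bialg_hom_counit h). Qed.

Definition bialg_corestrict : bialg_hom Y (subbialg_bialg D) :=
  BialgHom corestrict_comul corestrict_counit.

End Corestriction.

Lemma subbialg_inclP (k : fieldType) (A : bialgType k) (D : subbialg A)
    (x : subbialg_bialg D) : subbialg_set D (subbialg_inclusion D x).
Proof. exact/subbialg_predP/valP. Qed.

Theorem mainTheorem5 (k : fieldType) (J : category) (F : functor J (BiAlg k))
    (P : BiAlg k) (p : forall j : J, hom P (F j))
    (hP : is_product (X := fun j : J => F j) p)
    (Q : BiAlg k) (q : forall u : arrow J, hom Q (F (cod u)))
    (hQ : is_product (X := fun u : arrow J => F (cod u)) q)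
    (f g : hom P Q)
    (hf : forall u : arrow J, q u \oc f = p (cod u))
    (hg : forall u : arrow J, q u \oc g = fmap F (arr u) \oc p (dom u)) :
  exists D : subbialg P,
    subbialg_set D = sweedler_equalizer f g /\
    is_limit (F := F) (L := subbialg_bialg D)
      (fun j : J => p j \oc (subbialg_inclusion D : @hom (BiAlg k) _ _)).
Proof.
pose D := sweedler_subbialg f g.
pose e : @hom (BiAlg k) (subbialg_bialg D) P := subbialg_inclusion D.
exists D; split=> //; split.
- move=> i j u.
  have fge : f \oc e = g \oc e.
    apply: bialg_hom_eq => x.
    exact: sweedler_equalizer_eq (subbialg_inclP (D := D) x).
  by rewrite catcompA -(hg (Arrow u)) -(hf (Arrow u)) -!catcompA fge.
- move=> Y psi psi_cone.
  have [h [hpsi h_uniq]] := hP Y psi.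
  have fgh : f \oc h = g \oc h.
    have [r [_ r_uniq]] := hQ Y (fun u : arrow J => psi (cod u)).
    rewrite -(r_uniq (f \oc h)); last by move=> u; rewrite catcompA hf.
    apply: r_uniq => u.
    by rewrite catcompA hg -catcompA hpsi; exact: psi_cone.
  have hD y : sweedler_equalizer f g (h y).
    apply: sweedler_equalizer_range => {}y.
    exact: (congr1 (fun r : bialg_hom Y Q => r y) fgh).
  exists (bialg_corestrict (D := D) hD : @hom (BiAlg k) _ _).
  split=> [j|h' h'psi]; first by rewrite -hpsi; exact: bialg_hom_eq.
  have hE : h = e \oc h'.
    by apply: h_uniq => j; rewrite catcompA; exact: h'psi.
  apply: bialg_hom_eq => y; apply: subbialg_incl_inj.
  exact: (congr1 (fun r : bialg_hom Y P => r y) hE).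
Qed.
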